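(* Let $\mathcal{MC}$ be the family of all $\exists$-saturated maximal $\mathsf{FOL\Box}$-consistent sets and $R=\{\langle\Gamma,\Delta\rangle\in\mathcal{MC}\times\mathcal{MC}: \text{for every formula } A,\ \Box A\in\Gamma\Rightarrow A\in\Delta\}$. Then $R$ is the universal relation on $\mathcal{MC}$, i.e. $R=\mathcal{MC}\times\mathcal{MC}$.
   Context: Language $\mathcal{L}(\forall,\Box)$: first-order language with identity $=$, predicate symbols, variables, no constants or function symbols, connectives $\neg,\to$, quantifier $\forall$, modal operator $\Box$ (arbitrary nesting); $\Diamond:=\neg\Box\neg$. A formula is $\Box$-free if it contains no $\Box$. $\mathsf{FOL}$ is the set of $\Box$-free theses of classical first-order logic with identity. An occurrence of $x$ in $A$ is $\forall\Box$-bound if it is in the scope of a quantifier on $x$ or inside the scope of some $\Box$; otherwise $\forall\Box$-free. $x$ is a $\forall\Box$-free variable of $A$ if it has a $\forall\Box$-free occurrence. $A(^y/_x)$ is the simultaneous replacement of every $\forall\Box$-free occurrence of $x$ by $y$, provided $y$ is not captured by a quantifier. $\mathsf{FOL\Box}$ is the smallest set of formulas containing all instances of propositional tautologies and all instances of: $\Box(A\to B)\to(\Box A\to\Box B)$; $\Box A\to A$; $\neg\Box A\to\Box\neg\Box A$; $\forall xA\to A(^y/_x)$ (admissible $\forall\Box$-free substitution); $\forall x(A\to B)\to(A\to\forall xB)$ if $x$ is not $\forall\Box$-free in $A$; $x=x$; $x=y\wedge A(x)\to A(y)$ for $\Box$-free $A$ (usual first-order identity axiom); $\Box A\to\forall xA$;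 $\neg\Box A$ for every $\Box$-free $A\notin\mathsf{FOL}$; closed under: $A\in\mathsf{FOL\Box}\Rightarrow\Box A\in\mathsf{FOL\Box}$, and modus ponens. A set $\Gamma$ is $\mathsf{FOL\Box}$-consistent if there is no finite $\{B_1,\dots,B_k\}\subseteq\Gamma$ with $\neg(B_1\wedge\dots\wedge B_k)\in\mathsf{FOL\Box}$; maximal consistent if consistent and no proper superset is consistent. $\Gamma$ is $\exists$-saturated if for every $\neg\forall xA\in\Gamma$ there is a variable $y$ with $A(^y/_x)$ admissible and $\neg A(^y/_x)\in\Gamma$. *)

(* Defs.v *)
From Stdlib Require List.
From mathcomp Require Import all_boot.
From mathcomp Require Import classical_sets.

Set Implicit Arguments.
Unset Strict Implicit.
Unset Printing Implicit Defensive.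

Local Open Scope classical_set_scope.

Record signature := Signature { psym : Type; arity : psym -> nat }.

(* Individual variables are the natural numbers. *)
Inductive form (S : signature) : Type :=
| fPred (p : psym S) of (arity p).-tuple nat
| fEq of nat & nat
| fNeg of form S
| fImp of form S & form S
| fAll of nat & form S
| fBox of form S.

Arguments fEq {S}.

Definition fAnd (S : signature) (A B : form S) : form S :=
  fNeg (fImp A (fNeg B)).

Fixpoint boxfree (S : signature) (A : form S) : bool :=
  match A with
  | fPred _ _ | fEq _ _ => true
  | fNeg B => boxfree B
  | fImp B C => boxfree B && boxfree C
  | fAll _ B => boxfree B
  | fBox _ => false
  end.

(* [x] is a forall-box-free variable of [A]: every occurrence inside the scope
   of a box counts as bound. *)
Fixpoint fbfree (S : signature) (x : nat) (A : form S) : bool :=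
  match A with
  | fPred _ t => x \in (t : seq nat)
  | fEq u v => (x == u) || (x == v)
  | fNeg B => fbfree x B
  | fImp B C => fbfree x B || fbfree x C
  | fAll z B => (x != z) && fbfree x B
  | fBox _ => false
  end.

Definition rename (x y u : nat) : nat := if u == x then y else u.

(* [subst x y A] is A(y/x); it has its intended meaning only when
   [admissible x y A] holds. *)
Fixpoint subst (S : signature) (x y : nat) (A : form S) : form S :=
  match A with
  | fPred p t => fPred [tuple of map (rename x y) t]
  | fEq u v => fEq (rename x y u) (rename x y v)
  | fNeg B => fNeg (subst x y B)
  | fImp B C => fImp (subst x y B) (subst x y C)
  | fAll z B => if z == x then fAll z B else fAll z (subst x y B)
  | fBox B => fBox B
  end.

(* No forall-box-free occurrence of [x] in [A] lies in the scope of a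
   quantifier on [y]. *)
Fixpoint admissible (S : signature) (x y : nat) (A : form S) : bool :=
  match A with
  | fPred _ _ | fEq _ _ | fBox _ => true
  | fNeg B => admissible x y B
  | fImp B C => admissible x y B && admissible x y C
  | fAll z B => fbfree x (fAll z B) ==> (z != y) && admissible x y B
  end.

Inductive pform : Type :=
| pVar of nat
| pNeg of pform
| pImp of pform & pform.

Fixpoint peval (v : nat -> bool) (p : pform) : bool :=
  match p with
  | pVar n => v n
  | pNeg q => ~~ peval v q
  | pImp q r => peval v q ==> peval v r
  end.

Fixpoint pinst (S : signature) (s : nat -> form S) (p : pform) : form S :=
  match p with
  | pVar n => s n
  | pNeg q => fNeg (pinst s q)
  | pImp q r => fImp (pinst s q) (pinst s r)
  end.

Definition taut_instance (S : signature) (A : form S) : Prop :=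
  exists (p : pform) (s : nat -> form S),
    (forall v, peval v p) /\ A = pinst s p.

(* A standard Hilbert calculus for classical first-order logic with identity,
   in which every formula of a derivation is box-free.  On box-free formulas
   [fbfree], [subst] and [admissible] are the usual first-order notions. *)
Inductive FOL (S : signature) : form S -> Prop :=
| FOL_taut A : boxfree A -> taut_instance A -> FOL A
| FOL_inst x y A : boxfree A -> admissible x y A ->
    FOL (fImp (fAll x A) (subst x y A))
| FOL_dist x A B : boxfree A -> boxfree B -> ~~ fbfree x A ->
    FOL (fImp (fAll x (fImp A B)) (fImp A (fAll x B)))
| FOL_refl x : FOL (fEq x x)
| FOL_leibniz x y A : boxfree A -> admissible x y A ->
    FOL (fImp (fAnd (fEq x y) A) (subst x y A))
| FOL_mp A B : FOL (fImp A B) -> FOL A -> FOL B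
| FOL_gen x A : FOL A -> FOL (fAll x A).

Inductive FOLBox (S : signature) : form S -> Prop :=
| FOLBox_taut A : taut_instance A -> FOLBox A
| FOLBox_K A B : FOLBox (fImp (fBox (fImp A B)) (fImp (fBox A) (fBox B)))
| FOLBox_T A : FOLBox (fImp (fBox A) A)
| FOLBox_5 A : FOLBox (fImp (fNeg (fBox A)) (fBox (fNeg (fBox A))))
| FOLBox_inst x y A : admissible x y A ->
    FOLBox (fImp (fAll x A) (subst x y A))
| FOLBox_dist x A B : ~~ fbfree x A ->
    FOLBox (fImp (fAll x (fImp A B)) (fImp A (fAll x B)))
| FOLBox_refl x : FOLBox (fEq x x)
| FOLBox_leibniz x y A : boxfree A -> admissible x y A ->
    FOLBox (fImp (fAnd (fEq x y) A) (subst x y A))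
| FOLBox_boxall x A : FOLBox (fImp (fBox A) (fAll x A))
| FOLBox_nonthesis A : boxfree A -> ~ FOL A -> FOLBox (fNeg (fBox A))
| FOLBox_nec A : FOLBox A -> FOLBox (fBox A)
| FOLBox_mp A B : FOLBox (fImp A B) -> FOLBox A -> FOLBox B.

(* The nonempty finite subset {B_1, ..., B_k} is listed as [B] followed by
   [Bs], and its conjunction is associated to the left. *)
Definition consistent (S : signature) (Gamma : set (form S)) : Prop :=
  ~ exists (B : form S) (Bs : seq (form S)),
      (forall C, List.In C (B :: Bs) -> Gamma C) /\
      FOLBox (fNeg (foldl (@fAnd S) B Bs)).

Definition maximal_consistent (S : signature) (Gamma : set (form S)) : Prop :=
  consistent Gamma /\
  forall Delta : set (form S), Gamma `<` Delta -> ~ consistent Delta.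

Definition exists_saturated (S : signature) (Gamma : set (form S)) : Prop :=
  forall x A, Gamma (fNeg (fAll x A)) ->
    exists y, admissible x y A /\ Gamma (fNeg (subst x y A)).

Definition MC (S : signature) : set (set (form S)) :=
  [set Gamma | exists_saturated Gamma /\ maximal_consistent Gamma].

Arguments MC : clear implicits.

Definition canonical_rel (S : signature) : set (set (form S) * set (form S)) :=
  [set GD | (MC S `*` MC S) GD /\
            forall A, GD.1 (fBox A) -> GD.2 A].

Arguments canonical_rel : clear implicits.

(* Main.v *)
Require Import Defs.
From Stdlib Require List.
From mathcomp Require Import all_boot.
From mathcomp Require Import boolp classical_sets.

Local Open Scope classical_set_scope.

(** Every boxed formula is decided by FOLBox.  Indeed every formula [A] is
    provably equivalent to a box-free formula [A']: inductively, [fBox A] is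
    equivalent to [fBox A'], which is provable when [A'] is in FOL and refutable
    otherwise, so that it may be replaced by [fEq 0 0] or its negation.  Hence
    if [fBox A] belongs to some consistent set, then [A] is a thesis and
    belongs to every maximal consistent set. *)

(** Taking the instance from a list lets propositional theses be checked by truth table; [fEq 0 0]
    is an arbitrary filler for variables beyond the list. *)
Lemma FOLBox_pinst (S : signature) (p : pform) (s : seq (form S)) :
  (forall v, peval v p) -> FOLBox (pinst (nth (fEq 0 0) s) p).
Proof. by move=> tp; apply: FOLBox_taut; exists p, (nth (fEq 0 0) s). Qed.

Lemma FOLBox_imp_refl (S : signature) (A : form S) : FOLBox (fImp A A).
Proof.
apply: (@FOLBox_pinst _ (pImp (pVar 0) (pVar 0)) [:: A]).
by move=> v /=; case: (v 0).
Qed.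

Lemma FOLBox_trans (S : signature) (A B C : form S) :
  FOLBox (fImp A B) -> FOLBox (fImp B C) -> FOLBox (fImp A C).
Proof.
move=> AB BC; apply: FOLBox_mp BC; apply: FOLBox_mp AB.
apply: (@FOLBox_pinst _ (pImp (pImp (pVar 0) (pVar 1))
  (pImp (pImp (pVar 1) (pVar 2)) (pImp (pVar 0) (pVar 2)))) [:: A; B; C]).
by move=> v /=; case: (v 0); case: (v 1); case: (v 2).
Qed.

Lemma FOLBox_weaken (S : signature) (A B : form S) :
  FOLBox B -> FOLBox (fImp A B).
Proof.
apply: FOLBox_mp.
apply: (@FOLBox_pinst _ (pImp (pVar 0) (pImp (pVar 1) (pVar 0))) [:: B; A]).
by move=> v /=; case: (v 0); case: (v 1).
Qed.

Lemma FOLBox_contra (S : signature) (A B : form S) :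
  FOLBox (fImp A B) -> FOLBox (fImp (fNeg B) (fNeg A)).
Proof.
apply: FOLBox_mp.
apply: (@FOLBox_pinst _ (pImp (pImp (pVar 0) (pVar 1))
  (pImp (pNeg (pVar 1)) (pNeg (pVar 0)))) [:: A; B]).
by move=> v /=; case: (v 0); case: (v 1).
Qed.

Lemma FOLBox_explosion (S : signature) (A B : form S) :
  FOLBox (fNeg A) -> FOLBox (fImp A B).
Proof.
apply: FOLBox_mp.
apply: (@FOLBox_pinst _ (pImp (pNeg (pVar 0)) (pImp (pVar 0) (pVar 1)))
  [:: A; B]).
by move=> v /=; case: (v 0); case: (v 1).
Qed.

Lemma FOLBox_dneg (S : signature) (A : form S) :
  FOLBox A -> FOLBox (fNeg (fNeg A)).
Proof.
apply: FOLBox_mp.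
apply: (@FOLBox_pinst _ (pImp (pVar 0) (pNeg (pNeg (pVar 0)))) [:: A]).
by move=> v /=; case: (v 0).
Qed.

Lemma FOLBox_imp_mono (S : signature) (A A' B B' : form S) :
  FOLBox (fImp A' A) -> FOLBox (fImp B B') ->
  FOLBox (fImp (fImp A B) (fImp A' B')).
Proof.
move=> A'A BB'; apply: FOLBox_mp BB'; apply: FOLBox_mp A'A.
apply: (@FOLBox_pinst _ (pImp (pImp (pVar 1) (pVar 0))
  (pImp (pImp (pVar 2) (pVar 3))
    (pImp (pImp (pVar 0) (pVar 2)) (pImp (pVar 1) (pVar 3)))))
  [:: A; A'; B; B']).
by move=> v /=; case: (v 0); case: (v 1); case: (v 2); case: (v 3).
Qed.

Lemma FOLBox_and_mono (S : signature) (A A' B B' : form S) :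
  FOLBox (fImp A A') -> FOLBox (fImp B B') ->
  FOLBox (fImp (fAnd A B) (fAnd A' B')).
Proof.
by move=> AA' BB'; apply/FOLBox_contra/FOLBox_imp_mono/FOLBox_contra.
Qed.

Lemma FOLBox_andr (S : signature) (A B : form S) :
  FOLBox A -> FOLBox (fImp B (fAnd A B)).
Proof.
apply: FOLBox_mp.
apply: (@FOLBox_pinst _ (pImp (pVar 0) (pImp (pVar 1)
  (pNeg (pImp (pVar 0) (pNeg (pVar 1)))))) [:: A; B]).
by move=> v /=; case: (v 0); case: (v 1).
Qed.

Lemma FOLBox_andl (S : signature) (A B : form S) :
  FOLBox B -> FOLBox (fImp A (fAnd A B)).
Proof.
apply: FOLBox_mp.
apply: (@FOLBox_pinst _ (pImp (pVar 1) (pImp (pVar 0)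
  (pNeg (pImp (pVar 0) (pNeg (pVar 1)))))) [:: A; B]).
by move=> v /=; case: (v 0); case: (v 1).
Qed.

(** Generalization is not a primitive rule here: it is necessitation followed by the axiom
    [FOLBox_boxall]. *)
Lemma FOLBox_gen (S : signature) (x : nat) (A : form S) :
  FOLBox A -> FOLBox (fAll x A).
Proof. by move/FOLBox_nec; apply: FOLBox_mp; apply: FOLBox_boxall. Qed.

Lemma subst_id (S : signature) (x : nat) (A : form S) : subst x x A = A.
Proof.
have rid u : rename x x u = u by rewrite /rename; case: eqP.
elim: A => //= [p t|u v|B ->|B -> C ->|z B ->] //; last by case: eqP.
- by congr fPred; apply: val_inj; rewrite /= (eq_map rid) map_id.
- by rewrite !rid.
Qed.

Lemma admissible_id (S : signature) (x : nat) (A : form S) : admissible x x A.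
Proof.
elim: A => //= [B -> C -> //|z B ->].
by rewrite andbT eq_sym; apply/implyP => /andP[].
Qed.

Lemma FOLBox_all_mono (S : signature) (x : nat) (A B : form S) :
  FOLBox (fImp A B) -> FOLBox (fImp (fAll x A) (fAll x B)).
Proof.
move=> AB.
have allA : FOLBox (fImp (fAll x A) A).
  (* Instantiating [x] by itself is always admissible and changes nothing. *)
  by rewrite -{2}(subst_id S x A); apply/FOLBox_inst/admissible_id.
have := FOLBox_gen _ x _ (FOLBox_trans _ _ _ _ allA AB).
(* The side condition holds because [x] is bound in [fAll x A]. *)
by apply: FOLBox_mp; apply: FOLBox_dist; rewrite /= eqxx.
Qed.

Lemma FOLBox_box_mono (S : signature) (A B : form S) :
  FOLBox (fImp A B) -> FOLBox (fImp (fBox A) (fBox B)).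
Proof. by move/FOLBox_nec; apply: FOLBox_mp; apply: FOLBox_K. Qed.

Lemma FOL_sub_FOLBox (S : signature) (A : form S) : FOL A -> FOLBox A.
Proof.
elim=> {A} [A _ ?|x y A _ ?|x A B _ _ ?|x|x y A ? ?|A B _ AB _ hA|x A _ hA].
- exact: FOLBox_taut.
- exact: FOLBox_inst.
- exact: FOLBox_dist.
- exact: FOLBox_refl.
- exact: FOLBox_leibniz.
- exact: FOLBox_mp AB hA.
- exact: FOLBox_gen.
Qed.

(** Excluded middle on [FOL A]: theses are necessitated, and for non-theses the refutation of the
    box is an axiom. *)
Lemma FOLBox_box_decided_boxfree (S : signature) (A : form S) :
  boxfree A -> FOLBox (fBox A) \/ FOLBox (fNeg (fBox A)).
Proof.
move=> bA; have [folA|nfolA] := pselect (FOL A).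
- by left; apply/FOLBox_nec/FOL_sub_FOLBox.
- by right; apply: FOLBox_nonthesis.
Qed.

(** Boxing is monotone, so [A' -> A] transfers a proof of [fBox A'], and [A -> A'] transfers a
    refutation. *)
Lemma FOLBox_box_decided_equiv (S : signature) (A A' : form S) :
  boxfree A' -> FOLBox (fImp A A') -> FOLBox (fImp A' A) ->
  FOLBox (fBox A) \/ FOLBox (fNeg (fBox A)).
Proof.
move=> bA' AA' A'A.
have [bxA'|nbxA'] := FOLBox_box_decided_boxfree _ _ bA'; [left|right].
- by apply: FOLBox_mp bxA'; apply: FOLBox_box_mono.
- by apply: FOLBox_mp nbxA'; apply/FOLBox_contra/FOLBox_box_mono.
Qed.

(** Both implications are theses, hence survive generalization, so the induction passes under
    quantifiers. *)
Lemma boxfree_equiv (S : signature) (A : form S) :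
  exists A', [/\ boxfree A', FOLBox (fImp A A') & FOLBox (fImp A' A)].
Proof.
elim: A => [p t|u v|B [B' [bB' BB' B'B]]|B [B' [bB' BB' B'B]] C [C' [bC' CC' C'C]]
           |z B [B' [bB' BB' B'B]]|B [B' [bB' BB' B'B]]].
- by exists (fPred t); split=> //; apply: FOLBox_imp_refl.
- by exists (fEq u v); split=> //; apply: FOLBox_imp_refl.
- by exists (fNeg B'); split=> //; apply: FOLBox_contra.
- by exists (fImp B' C'); split; rewrite /= ?bB' //; apply: FOLBox_imp_mono.
- by exists (fAll z B'); split=> //; apply: FOLBox_all_mono.
have [bxB|nbxB] := FOLBox_box_decided_equiv _ _ _ bB' BB' B'B.
- exists (fEq 0 0); split=> //; apply: FOLBox_weaken => //.
  exact: FOLBox_refl.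
- exists (fNeg (fEq 0 0)); split=> //; first exact: FOLBox_explosion.
  by apply: FOLBox_explosion; apply/FOLBox_dneg/FOLBox_refl.
Qed.

Lemma FOLBox_box_decided (S : signature) (A : form S) :
  FOLBox (fBox A) \/ FOLBox (fNeg (fBox A)).
Proof.
by have [A' [bA' AA' A'A]] := boxfree_equiv S A;
  apply: FOLBox_box_decided_equiv AA' A'A.
Qed.

Lemma consistent_nthesis (S : signature) (Gamma : set (form S)) (A : form S) :
  consistent Gamma -> Gamma A -> ~ FOLBox (fNeg A).
Proof.
by move=> cG GA nA; apply: cG; exists A, [::]; split=> // C [<-|[]].
Qed.

(* The first alternative is needed because conjunctions are nonempty. *)
Lemma foldl_and_drop_thesis (S : signature) (Delta : set (form S))
    (A B : form S) (Bs : seq (form S)) :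
  FOLBox A -> (forall C, List.In C (B :: Bs) -> Delta C \/ C = A) ->
  FOLBox (foldl (@fAnd S) B Bs) \/
  exists B' Bs', (forall C, List.In C (B' :: Bs') -> Delta C) /\
    FOLBox (fImp (foldl (@fAnd S) B' Bs') (foldl (@fAnd S) B Bs)).
Proof.
move=> hA.
(* Conjunctions associate to the left, so the outermost conjunct is the last entry of the list. *)
elim/last_ind: Bs => [|Bs D IH] sub.
  have [DB|->] := sub B (or_introl erefl); last by left.
  right; exists B, [::]; split; first by move=> C [<-|[]].
  exact: FOLBox_imp_refl.
have subBs C : List.In C (B :: Bs) -> Delta C \/ C = A.
  move=> CBs; apply: sub; rewrite -cats1.
  by case: CBs => [|CBs]; [left|right; apply/List.in_or_app; left].
have DD : Delta D \/ D = A.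
  by apply: sub; right; rewrite -cats1; apply/List.in_or_app; right; left.
rewrite foldl_rcons.
case: (IH subBs) DD => [hBs|[B' [Bs' [sub' imp']]]] [DD|->].
- right; exists D, [::]; split; first by move=> C [<-|[]].
  exact: FOLBox_andr.
- by left; apply: FOLBox_mp hA; apply: FOLBox_andr.
- right; exists B', (rcons Bs' D); split.
    move=> C [<-|]; first by apply: sub'; left.
    rewrite -cats1 => inC.
    have [CBs'|[<-|[]]] := List.in_app_or _ _ _ inC; last by [].
    by apply: sub'; right.
  by rewrite foldl_rcons; apply/FOLBox_and_mono/FOLBox_imp_refl.
- right; exists B', Bs'; split=> //.
  by apply: FOLBox_trans imp' _; apply: FOLBox_andl.
Qed.

(* If FOLBox were inconsistent, the empty set would be maximal consistent,
   hence the hypothesis on [C]. *)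
Lemma maximal_consistent_thesis (S : signature) (Delta : set (form S))
    (A C : form S) :
  ~ FOLBox C -> maximal_consistent Delta -> FOLBox A -> Delta A.
Proof.
move=> nC [cD maxD] hA; apply: contrapT => nDA.
(* Adding [A] would give a proper superset, hence a refutable conjunction; the thesis [A] can then
   be dropped from it. *)
have lt : Delta `<` (Delta `|` [set A]).
  by split=> [X DX|sub]; [left|apply/nDA/sub; right].
apply: (maxD _ lt) => -[B [Bs [sub nBs]]].
have [hBs|[B' [Bs' [sub' imp']]]] := foldl_and_drop_thesis _ _ _ _ _ hA sub.
(* A conjunction both proved and refuted would make [C] a thesis. *)
- by apply: nC; apply: FOLBox_mp hBs; apply: FOLBox_explosion.
- apply: cD; exists B', Bs'; split=> //.
  by apply: FOLBox_mp nBs; apply: FOLBox_contra.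
Qed.

Theorem theorem2 (S : signature) : canonical_rel S = MC S `*` MC S.
Proof.
apply/seteqP; split=> [GD []//|[Gamma Delta] GD]; split=> //= A GA.
have [[_ [cG _]] [_ mD]] := GD.
(* This serves twice: it excludes that [fBox A] is refutable, and it makes [fNeg (fBox A)] the
   non-thesis required for the maximality argument on [Delta]. *)
have nnbxA := consistent_nthesis _ _ _ cG GA.
have [bxA|//] := FOLBox_box_decided _ A.
by apply: (maximal_consistent_thesis _ _ _ _ nnbxA mD);
  apply: FOLBox_mp bxA; apply: FOLBox_T.
Qed.
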